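(* Let $G$ be a 2-vertex-connected outerplanar graph that admits a tree $t$-spanner. Then there exists a tree $t$-spanner $T$ of $G$ satisfying: (P1) for every E-face $f$ of $G$, there is exactly one external edge $e\in E(f)$ with $e\notin E(T)$; (P2) for every external edge $(u,v)\notin E(T)$, letting $C$ be the cycle $P_T(u,v)+(u,v)$, exactly one interior face of $G[V(C)]$ is an E-face of $G$.
   Context: All graphs are simple, finite, connected, undirected, unweighted. An outerplanar graph is embedded (uniquely, when 2-connected) in the plane with all vertices on the boundary of the exterior face $f_{ext}$. Bounded faces are interior faces; for a face $f$, $V(f)$ and $E(f)$ are its vertex and edge sets. An edge is external if it lies in $E(f_{ext})$ and internal otherwise. An E-face is an interior face sharing an edge with the exterior face (i.e. containing an external edge); other interior faces are I-faces. $P_T(u,v)$ is the $u$–$v$ path in the tree $T$. $d_H$ is shortest-path distance; a tree $t$-spanner of $G$ is a spanning tree $T$ with $d_T(u,v)\le t\cdot d_G(u,v)$ for all $u,v$. *)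

(* Defs.v *)
From HB Require Import structures.
From mathcomp Require Import all_boot all_order all_algebra all_fingroup.
Set Implicit Arguments.
Unset Strict Implicit.
Unset Printing Implicit Defensive.
Import GRing.Theory Num.Theory.

Record sgraph (V : finType) := SGraph {
  adj :> rel V;
  adj_sym : symmetric adj;
  adj_irr : irreflexive adj }.

Section Graphs.
Variable V : finType.
Implicit Types (G T : sgraph V) (S : {set V}).

Definition edges G : {set {set V}} :=
  [set [set d.1; d.2] | d : V * V & G d.1 d.2].

(* Adjacency of the induced subgraph G[S]. *)
Definition induced G S : rel V :=
  [rel x y | [&& x \in S, y \in S & G x y]].

Definition connected G S : Prop :=
  {in S &, forall x y, connect (induced G S) x y}.

Definition biconnected G : Prop :=
  [/\ 2 < #|V|, connected G [set: V] & forall z, connected G [set~ z]].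

(* The value is #|V| when there is no walk from u to v. *)
Definition dist G (u v : V) : nat :=
  find (fun k => [exists p : k.-tuple V, path G u p && (last u p == v)])
       (iota 0 #|V|).

(* [ucycle] also accepts [:: x; y] when x and y are adjacent; it traverses one
   edge twice and is not a cycle of the graph. *)
Definition acyclic G : Prop := forall c : seq V, ucycle G c -> size c <= 2.

Definition spanning_tree G T : Prop :=
  [/\ subrel T G, connected T [set: V] & acyclic T].

Definition tree_spanner (R : realFieldType) (t : R) G T : Prop :=
  spanning_tree G T /\
  forall u v, ((dist T u v)%:R <= t * (dist G u v)%:R)%R.

(* The vertices of the path are those of u :: p. *)
Definition simple_path T (u v : V) (p : seq V) : Prop :=
  [/\ path T u p, uniq (u :: p) & last u p = v].

Definition dart G := {d : V * V | G d.1 d.2}.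

Section Darts.
Variable G : sgraph V.
Implicit Type d : dart G.

Definition src d : V := (val d).1.
Definition tgt d : V := (val d).2.

Lemma drev_subproof d : G (tgt d) (src d).
Proof. by rewrite adj_sym; exact: (valP d). Qed.

Definition drev d : dart G :=
  exist (fun x : V * V => G x.1 x.2) (tgt d, src d) (drev_subproof d).

Definition face_of (rotation : {perm dart G}) d : {set dart G} :=
  [set d' | fconnect (fun x => rotation (drev x)) d d'].

Definition face_set (rotation : {perm dart G}) : {set {set dart G}} :=
  [set face_of rotation d | d : dart G].

End Darts.

(* An embedding of a connected graph (with at least one edge) in the sphere, up
   to homeomorphism: a cyclic order of the darts leaving each vertex such that
   Euler's formula holds for the faces it determines. A face is represented by
   the set of darts having it on a fixed side. Choosing the exterior face turns
   the embedding in the sphere into an embedding in the plane; the embedding is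
   outerplanar when every vertex is on the boundary of that face. *)
Record outerplane_embedding (G : sgraph V) := OuterplaneEmbedding {
  rotation : {perm dart G};
  rotationP : forall d, porbit rotation d = [set d' | src d' == src d];
  Euler : #|V| + #|face_set rotation| = #|edges G| + 2;
  fext : {set dart G};
  fext_face : fext \in face_set rotation;
  fextP : forall v : V, exists2 d, d \in fext & src d = v }.

Section Faces.
Variables (G : sgraph V) (M : outerplane_embedding G).
Implicit Type f : {set dart G}.

Definition faces : {set {set dart G}} := face_set (rotation M).

Definition interior_faces : {set {set dart G}} := faces :\ fext M.

Definition face_edges f : {set {set V}} := [set [set src d; tgt d] | d in f].

Definition external_edges : {set {set V}} := face_edges (fext M).

Definition E_faces : {set {set dart G}} :=
  [set f in interior_faces | face_edges f :&: external_edges != set0].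

(* The plane embedding of G[S] is the one induced by M. Erasing an edge of G
   joins the two faces on its sides, so a face of G[S] is represented by the set
   of the faces of G that it contains: an equivalence class of faces of G,
   for the relation generated by sharing an edge that is not in G[S]. *)
Definition merged (S : {set V}) : rel {set dart G} :=
  [rel f f' | [exists d : dart G,
     [&& ~~ induced G S (src d) (tgt d),
         face_of (rotation M) d == f & face_of (rotation M) (drev d) == f']]].

Definition induced_faces (S : {set V}) : {set {set {set dart G}}} :=
  [set [set f' in faces | connect (merged S) f f'] | f in faces].

Definition induced_interior_faces (S : {set V}) : {set {set {set dart G}}} :=
  [set K in induced_faces S | fext M \notin K].

(* A face f of G, seen as a face of G[S], is the class [set f]. *)
Definition induced_E_faces (S : {set V}) : {set {set {set dart G}}} :=
  [set K in induced_interior_faces S | [exists f in E_faces, K == [set f]]].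

Definition P1 (T : sgraph V) : Prop :=
  forall f, f \in E_faces ->
    #|[set e in face_edges f :&: external_edges | e \notin edges T]| = 1.

Definition P2 (T : sgraph V) : Prop :=
  forall (u v : V) (p : seq V),
    [set u; v] \in external_edges -> [set u; v] \notin edges T ->
    simple_path T u v p ->
    #|induced_E_faces [set x in u :: p]| = 1.

End Faces.

End Graphs.

(* Main.v *)
Require Import Defs.
From mathcomp Require Import all_boot all_order all_algebra all_fingroup zify.
Set Implicit Arguments.
Unset Strict Implicit.
Unset Printing Implicit Defensive.
Import Order.TTheory GRing.Theory Num.Theory.

(** The edges outside a spanning tree T are dual to a spanning tree T* of the
    faces: they connect the faces because a union of faces has an even boundary,
    and there are as few of them as possible by Euler's formula. The fundamental
    cycle of an edge e outside T bounds the faces that e cuts off from the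
    exterior face in T*; all vertices of these faces lie on the cycle, because
    every vertex is on the exterior face.

    Take a tree t-spanner T with the fewest external edges. If every external
    edge of some E-face f is in T, let d be the first edge of the path of T* from
    f to the exterior face, and exchange d with an external edge e of f. This
    keeps the fundamental cycle of d. If the tree path of another edge of G
    contains e, then the fundamental cycle of that edge encloses f, hence passes
    through both ends of d, and d shortens it. So the exchange gives a tree
    t-spanner with fewer external edges, a contradiction. Two external edges of f
    outside T would close a cycle of T*, whence (P1). The faces inside the
    fundamental cycle of an external edge e form a component of T* minus the
    exterior face, which e alone joins to that face; by (P1) the E-face at e is
    its only E-face, whence (P2). *)

(** * Pairs, sequences and a counting bound for connecting links *)

Lemma set2_eq (V : finType) (x y u v : V) :
  [set x; y] = [set u; v] -> (x = u /\ y = v) \/ (x = v /\ y = u).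
Proof.
move=> E; have := (set21 x y, set22 x y, set21 u v, set22 u v).
rewrite {1 2}E -{3 4}E !inE => -[[[]]].
by do 4![case/orP=> /eqP ?]; subst; auto.
Qed.

Lemma split_two (V : eqType) (s : seq V) a b :
    a \in s -> b \in s -> a != b ->
  exists s1 s2 s3, s = s1 ++ a :: s2 ++ b :: s3 \/ s = s1 ++ b :: s2 ++ a :: s3.
Proof.
case/splitPr=> s1 s2; rewrite mem_cat inE => + nab.
rewrite eq_sym (negPf nab) /= => /orP[]/splitPr[q1 q2].
  by exists q1, q2, s2; right; rewrite -catA.
by exists s1, q1, q2; left.
Qed.

(** Grow a set [W] from one element: a link that leaves [W] has at most two ends, so it adds one
    element, and it is fresh because the links used so far have their ends in [W]. This serves for
    vertices joined by tree edges and for faces joined by edges off the tree. *)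
Lemma card_le_connecting (N L : finType) (A : {set N}) (F : {set L})
    (ends : L -> {set N}) :
    (forall l, l \in F -> #|ends l| <= 2) ->
    (forall W : {set N}, W != set0 -> W \proper A -> exists2 l, l \in F &
      (ends l :&: W != set0) && (ends l :&: (A :\: W) != set0)) ->
  #|A| <= #|F|.+1.
Proof.
move=> ends2 joinP; have [-> | [r rA]] := set_0Vmem A; first by rewrite cards0.
suff main k : k < #|A| -> exists (W : {set N}) (F' : {set L}),
  [/\ W \subset A, #|W| = k.+1, F' \subset F, #|F'| = k
    & forall l, l \in F' -> ends l \subset W].
  have A0 : 0 < #|A| by apply/card_gt0P; exists r.
  have [|W [F' [_ _ sF cF _]]] := main #|A|.-1; first by rewrite prednK.
  by rewrite -(prednK A0) ltnS -cF subset_leq_card.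
elim: k => [_ | k IHk ltkA].
  exists [set r], set0; rewrite sub1set cards1 cards0 sub0set.
  by split=> // l; rewrite inE.
have [W [F' [sWA cW sF cF endsF]]] := IHk (ltnW ltkA).
have [||l lF /andP[/set0Pn[x] + /set0Pn[y]]] := joinP W.
- by rewrite -card_gt0 cW.
- by rewrite properEcard sWA cW.
rewrite !inE => /andP[xl xW] /and3P[yl yW yA].
have nxy : x != y by apply: contraNneq yW => <-.
have el : ends l = [set x; y].
  by apply/esym/eqP; rewrite eqEcard subUset !sub1set xl yl cards2 nxy ends2.
have lF' : l \notin F'.
  by apply: contra yW => /endsF/subsetP; apply.
exists (y |: W), (l |: F'); rewrite !subUset !sub1set yA lF !cardsU1 yW lF' cW cF.
split=> // l'; rewrite !inE => /orP[/eqP->|/endsF sW].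
  by rewrite el subUset !sub1set !inE eqxx xW orbT.
by rewrite (subset_trans sW) ?subsetUr.
Qed.

(** * Paths, cuts and exchanges in trees *)

Section Trees.
Variable V : finType.
Implicit Types (G H T : sgraph V) (x y u v a b c d : V) (p : seq V).

Lemma mem_edges H x y : ([set x; y] \in edges H) = H x y.
Proof.
apply/imsetP/idP => [[[a b]] | Hxy]; last by exists (x, y); rewrite ?inE.
rewrite inE /= => Hab.
by case/set2_eq=> [] [-> ->]; rewrite // adj_sym.
Qed.

Lemma mem_edges_set H (e : {set V}) :
  e \in edges H -> exists x y, e = [set x; y] /\ H x y.
Proof. by case/imsetP=> -[x y]; rewrite inE /= => Hxy ->; exists x, y. Qed.

Lemma connectedP H : connected H [set: V] <-> forall x y, connect H x y.
Proof.
have E x y : connect (induced H [set: V]) x y = connect H x y.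
  by apply: eq_connect => a b; rewrite /induced /= !inE.
by split=> cH x y; [rewrite -E; apply: cH | rewrite E].
Qed.

Lemma dist_le_size H u p : path H u p -> dist H u (last u p) <= size p.
Proof.
move=> Hp; rewrite /dist; have [lt|ge] := ltnP (size p) #|V|; last first.
  by apply: leq_trans (find_size _ _) _; rewrite size_iota.
rewrite leqNgt; apply/negP => /(before_find 0).
rewrite nth_iota // add0n => /negbT/negP[]; apply/existsP; exists (in_tuple p).
by rewrite Hp eqxx.
Qed.

(** A simple path has fewer than [#|V|] steps, so the bounded search in [dist] succeeds; shortening
    the walk that it finds makes it simple. *)
Lemma ex_geodesic H u v :
  connect H u v -> exists2 p, simple_path H u v p & size p = dist H u v.
Proof.
have short p : path H u p -> exists2 q, simple_path H u (last u p) q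
                                      & size q <= size p.
  case/shortenP=> q Hq uq sq; exists q => //.
  by apply: uniq_leq_size => //; case/andP: uq.
case/connectP=> p0 /short[p1 [Hp1 up1 <-] _] ->.
set P := fun k => [exists p : k.-tuple V, path H u p && (last u p == last u p1)].
have hasP : has P (iota 0 #|V|).
  apply/hasP; exists (size p1).
    rewrite mem_iota /= add0n -[_ < _]/(size (u :: p1) <= _).
    by rewrite -(card_uniqP up1) max_card.
  by apply/existsP; exists (in_tuple p1); rewrite Hp1 eqxx.
have := nth_find 0 hasP; rewrite -/(dist H u (last u p1)).
have lt : dist H u (last u p1) < #|V| by move: hasP; rewrite has_find size_iota.
rewrite nth_iota // add0n => /existsP[q /andP[/short[r]] sr lr /eqP lq].
rewrite lq in sr; rewrite size_tuple in lr.
exists r => //; apply/eqP; rewrite eqn_leq lr /=.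
by case: sr => Hr _ <-; rewrite dist_le_size.
Qed.

End Trees.

Lemma cat_cons_uniq_inj (V : eqType) (w : V) s1 s2 t1 t2 :
    uniq (s1 ++ w :: s2) -> s1 ++ w :: s2 = t1 ++ w :: t2 ->
  s1 = t1 /\ s2 = t2.
Proof.
have idx (r1 r2 : seq V) : uniq (r1 ++ w :: r2) -> index w (r1 ++ w :: r2) = size r1.
  rewrite cat_uniq /= negb_or index_cat => /and3P[_ /andP[/negPf-> _] _].
  by rewrite /= eqxx addn0.
move=> U E; have := idx _ _ U; rewrite E idx -?E // => /esym sz.
by move/eqP: E; rewrite eqseq_cat // eqseq_cons eqxx => /andP[/eqP-> /eqP->].
Qed.

(** * Edge cuts and simple paths in forests *)

Section Cuts.
Variable V : finType.
Implicit Types (H T : sgraph V) (x y z u v w a b : V) (p q : seq V) (A : pred V).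

(* In a forest, the edge [a b] lies on the path from x to y iff [A] separates x
   from y: see [cut_mem_path] and [cut_path_sep]. *)
Definition cut H a b A : Prop :=
  [/\ A a, ~~ A b & forall x y, H x y -> A x -> ~~ A y -> x = a /\ y = b].

Lemma cutC H a b A : cut H a b A -> cut H b a (predC A).
Proof.
case=> Aa Ab uA; split=> [//||x y Hxy /= nAx] /=; first by rewrite Aa.
by rewrite negbK => Ay; rewrite adj_sym in Hxy; case: (uA y x Hxy Ay nAx).
Qed.

(** The side [A] is the component of [a] after deletion of the edge; a path from [a] to [b] in what
    remains would close up to a cycle. *)
Lemma acyclic_cut H a b : acyclic H -> H a b -> exists A, cut H a b A.
Proof.
move=> acH Hab; pose D := [rel x y | H x y && ([set x; y] != [set a; b])].
exists (connect D a); split=> [||x y Hxy Dx nDy]; first exact: connect0.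
  apply/negP => /connectP[p0 Dp0]; case/shortenP: Dp0 => p Dp Up _ lp.
  have Hp : path H a p by apply: sub_path Dp => x y /andP[].
  have /acH : ucycle H (a :: p) by rewrite /ucycle Up /= rcons_path Hp -lp adj_sym Hab.
  case: p lp Dp {Up Hp} => [|z [|? ?]] //= [].
    by move=> eba; rewrite eba adj_irr in Hab.
  by move=> <-; rewrite eqxx andbF.
have : ~~ D x y.
  by apply: contra nDy => Dxy; apply: connect_trans Dx _; apply: connect1.
rewrite /= Hxy negbK => /eqP/set2_eq[//|[_ ya]].
by rewrite ya connect0 in nDy.
Qed.

Lemma cut_stay H a b A z q :
  cut H a b A -> path H z q -> ~~ A z -> a \notin q -> all (predC A) (z :: q).
Proof.
move=> cA; elim: q z => [|y q IHq] z /=; first by rewrite andbT.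
case/andP=> Hzy Hq nAz; rewrite inE negb_or nAz => /andP[nay naq] /=.
apply: IHq => //; apply: contra nay => Ay; apply/eqP.
by rewrite adj_sym in Hzy; case: cA => _ _ /(_ _ _ Hzy Ay nAz)[].
Qed.

(** A cycle that leaves [A] along its first edge [x y] stays outside, as it avoids [x]. Its closing
    edge also joins the two sides, so its last vertex is [y], a repetition. *)
Lemma cut_acyclic H : (forall a b, H a b -> exists A, cut H a b A) -> acyclic H.
Proof.
move=> cutH [|x [|y [|z c]]] // /andP[/= /and3P[Hxy Hyz Hc] Uc].
have [A cA] := cutH _ _ Hxy; have [Ax nAy uA] := cA.
have /cut_stay -/(_ _ _ _ cA nAy) : path H y (z :: c).
  by move: Hc; rewrite /= rcons_path Hyz => /andP[].
case/and3P: Uc => + nyc _; rewrite inE negb_or => /andP[_ -> /(_ isT)/allP].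
move/(_ (last z c)); rewrite in_cons mem_last orbT => /(_ isT) /= nAl.
move: Hc; rewrite rcons_path adj_sym => /andP[_ /uA] /(_ Ax nAl)[_ ly].
by rewrite -ly mem_last in nyc.
Qed.

(** After the crossing, [A] could be entered again only at [a], which a simple path does not
    revisit. *)
Lemma cut_path H a b A x p :
    cut H a b A -> path H x p -> uniq (x :: p) -> A x ->
  all A (x :: p) \/ exists p1 p2, [/\ p = p1 ++ b :: p2, last x p1 = a,
    all A (x :: p1) & all (predC A) (b :: p2)].
Proof.
move=> cA; elim: p x => [|y p IHp] x; first by move=> _ _ /= ->; left.
move=> /= /andP[Hxy Hp] /andP[nxp Up] Ax; case: (boolP (A y)) => [Ay|nAy].
  have [/= /andP[_ ->] | [p1 [p2 [-> lp1 Ap1 nAp2]]]] := IHp y Hp Up Ay.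
    by left; rewrite Ax.
  by right; exists (y :: p1), p2; split=> //=; rewrite Ax.
have [_ _ /(_ _ _ Hxy Ax nAy)[xa yb]] := cA; subst x y.
right; exists [::], p; split=> //; first by rewrite /= Ax.
apply: cut_stay cA Hp nAy _; by apply: contra nxp; rewrite inE orbC => ->.
Qed.

Lemma cut_path_const H a b A x y p :
    cut H a b A -> simple_path H x y p -> A x = A y ->
  {in x :: p, forall z, A z = A x}.
Proof.
move=> cA [Hp Up <-]; case: (boolP (A x)) => [Ax /esym Al | nAx /esym nAl] z zp.
  have [/allP/(_ z zp) -> //|[p1 [p2 [pE _ _ /allP nA]]]] := cut_path cA Hp Up Ax.
  by have := nA (last b p2) (mem_last _ _); move: Al; rewrite pE last_cat /= => ->.
have [/allP/(_ z zp)/negPf //|[p1 [p2 [pE _ _ /allP AA]]]] :=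
  cut_path (cutC cA) Hp Up nAx.
have := AA (last a p2) (mem_last _ _).
by move: nAl; rewrite pE last_cat /= => ->.
Qed.

Lemma cut_mem_path H a b A x y p :
    cut H a b A -> simple_path H x y p -> A x (+) A y ->
  (a \in x :: p) && (b \in x :: p).
Proof.
move=> cA [Hp Up <-]; case: (boolP (A x)) => [Ax nAl | nAx /= Al].
  have [/allP/(_ _ (mem_last x p)) Al|[p1 [p2 [-> <- _ _]]]] := cut_path cA Hp Up Ax.
    by rewrite Al in nAl.
  by rewrite -cat_cons !mem_cat mem_last mem_head orbT.
have [/allP/(_ _ (mem_last x p))|[p1 [p2 [-> <- _ _]]]] :=
  cut_path (cutC cA) Hp Up nAx; first by rewrite /= Al.
by rewrite -cat_cons !mem_cat mem_last mem_head orbT.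
Qed.

Lemma cut_path_sep H a b A x y p :
    cut H a b A -> simple_path H x y p -> a \in x :: p -> b \in x :: p ->
  A x (+) A y.
Proof.
move=> cA sp ap bp; have [Aa nAb _] := cA; apply/contraT; rewrite negb_add => /eqP.
move=> E; move: nAb; rewrite (cut_path_const cA sp E bp).
by rewrite -(cut_path_const cA sp E ap) Aa.
Qed.

(** The only crossing of the path is at the edge [w z], and [w] lies strictly between [u] and [v],
    so the crossing does not lie outside that stretch. *)
Lemma cut_path_segment H w z A x y p s1 u s2 v s3 :
    cut H w z A -> simple_path H x y p ->
    x :: p = s1 ++ u :: s2 ++ v :: s3 -> w \in s2 ->
  A x (+) A y -> A u (+) A v.
Proof.
move=> cA [Hp Up ly] pE /splitPr ws2; case: ws2 pE => t1 t2.
rewrite -catA cat_cons -cat_cons catA => pE.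
have split_w q1 q2 : x :: p = q1 ++ w :: q2 -> s1 ++ u :: t1 = q1 /\ t2 ++ v :: s3 = q2.
  by move=> E; apply: cat_cons_uniq_inj (etrans (esym pE) E); rewrite -pE.
case: (boolP (A x)) => [Ax nAl | nAx /= Al].
  have [/allP/(_ _ (mem_last x p))|[p1 [p2 [pE' lw A1 A2]]]] :=
    cut_path cA Hp Up Ax; first by rewrite ly => Ay; rewrite Ay in nAl.
  have /split_w[e1 e2] : x :: p = belast x p1 ++ w :: z :: p2.
    by rewrite -lw -cat_rcons -lastI pE'.
  move: A1 A2; rewrite lastI -e1 -e2 all_rcons !all_cat /=.
  by case/and3P=> _ _ /andP[-> _] /and3P[_ /= /negPf-> _].
have [/allP/(_ _ (mem_last x p))|[p1 [p2 [pE' lw A1 A2]]]] :=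
  cut_path (cutC cA) Hp Up nAx; first by rewrite ly /= Al.
have /split_w[e1 e2] : x :: p = (x :: p1) ++ w :: p2 by rewrite pE'.
move: A1 A2; rewrite -e1 -e2 /= !all_cat /=.
by case/and3P=> _ /negPf-> _ /and4P[_ _ /negPn-> _].
Qed.

End Cuts.

(** * Walks and the stretch of edges *)

Section Walks.
Variable V : finType.
Implicit Types (G H T : sgraph V) (x y z : V).

(** Walks need not be simple, so that they concatenate with lengths adding up. *)
Definition walk H x y n : Prop :=
  exists2 p, path H x p & last x p = y /\ size p = n.

Lemma walk_cat H y x z m n : walk H x y m -> walk H y z n -> walk H x z (m + n).
Proof.
move=> [p Hp [<- <-]] [q Hq [<- <-]]; exists (p ++ q).
  by rewrite cat_path Hp.
by rewrite last_cat size_cat.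
Qed.

Lemma walk1 H x y : H x y -> walk H x y 1.
Proof. by move=> Hxy; exists [:: y]; rewrite /= ?Hxy. Qed.

Lemma walk_sym H x y n : walk H x y n -> walk H y x n.
Proof.
case=> p Hp [<- <-]; exists (rev (belast x p)); last first.
  rewrite size_rev size_belast; split=> //.
  by case: p {Hp} => //= y' p; rewrite rev_cons last_rcons.
by rewrite rev_path; apply: sub_path Hp => a b; rewrite /= adj_sym.
Qed.

Lemma dist_le_walk H x y n : walk H x y n -> dist H x y <= n.
Proof. by case=> p Hp [<- <-]; apply: dist_le_size. Qed.

Lemma dist_walk H x y : connect H x y -> walk H x y (dist H x y).
Proof. by case/ex_geodesic=> p [Hp _ lp] sp; exists p. Qed.

Lemma dist_adj H x y : H x y -> dist H x y = 1.
Proof.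
move=> Hxy; apply/eqP; rewrite eqn_leq (dist_le_walk (walk1 Hxy)) lt0n.
apply/eqP => d0; have [p _ [lp]] := dist_walk (connect1 Hxy).
rewrite d0 => /size0nil p0; move: lp Hxy; rewrite p0 /= => ->.
by rewrite adj_irr.
Qed.

Lemma tree_spanner_adj (R : realFieldType) (t : R) G T x y :
  tree_spanner t G T -> G x y -> ((dist T x y)%:R <= t)%R.
Proof. by case=> _ /(_ x y) + Gxy; rewrite (dist_adj Gxy) mulr1n mulr1. Qed.

(** Replacing each edge of a geodesic of [G] by a walk of [T] multiplies the length by at most [t];
    the same walks connect [T]. *)
Lemma tree_spannerP (R : realFieldType) (t : R) G T :
    subrel T G -> connected G [set: V] -> acyclic T ->
    (forall x y, G x y -> exists2 n, walk T x y n & (n%:R <= t)%R) ->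
  tree_spanner t G T.
Proof.
move=> sTG /connectedP cG acT wT.
have wG n x y : walk G x y n -> exists2 m, walk T x y m & (m%:R <= t * n%:R)%R.
  elim: n x => [|n IHn] x [[|z p]] /=.
  - by move=> _ [-> _]; exists 0; [exists [::] | rewrite mulr0].
  - by move=> _ [].
  - by move=> _ [].
  case/andP=> /wT[k wk le_k] Gp [lp [sp]].
  have [|m wm le_m] := IHn z; first by exists p.
  exists (k + m); first exact: walk_cat wk wm.
  by rewrite natrD -addn1 addnC natrD mulrDr mulr1 lerD.
split=> [|x y]; last first.
  have [m /dist_le_walk le_m] := wG _ _ _ (dist_walk (cG x y)).
  by apply: le_trans; rewrite ler_nat.
split=> //; apply/connectedP => x y.
have [m [p Tp [<- _]] _] := wG _ _ _ (dist_walk (cG x y)).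
by apply/connectP; exists p.
Qed.

End Walks.

(** * Exchange of a tree edge *)

Section Swap.
Variables (V : finType) (T : sgraph V) (a b u v : V).

(** The test [u != v] makes the relation irreflexive for all parameters. *)
Definition swap_rel : rel V :=
  [rel x y | T x y && ([set x; y] != [set a; b])
             || (u != v) && ([set x; y] == [set u; v])].

Lemma swap_sym : symmetric swap_rel.
Proof. by move=> x y; rewrite /swap_rel /= adj_sym setUC. Qed.

Lemma swap_irr : irreflexive swap_rel.
Proof.
move=> x; rewrite /swap_rel /= adj_irr /=; apply/negP => /andP[/eqP + /eqP/set2_eq].
by move=> n [] [? ?]; apply: n; subst.
Qed.

Definition swap := SGraph swap_sym swap_irr.

Lemma swapE x y : swap x y =
  T x y && ([set x; y] != [set a; b]) || (u != v) && ([set x; y] == [set u; v]).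
Proof. by []. Qed.

Lemma swap_mem_edges e :
  (e \in edges swap) =
    ((e \in edges T) && (e != [set a; b])) || (u != v) && (e == [set u; v]).
Proof.
apply/idP/idP => [/mem_edges_set[x [y [->]]]|]; first by rewrite swapE mem_edges.
case/orP=> /andP[].
  by case/mem_edges_set=> x [y [-> Txy]] ne; rewrite mem_edges swapE Txy ne.
by move=> nuv /eqP->; rewrite mem_edges swapE nuv eqxx orbT.
Qed.

Variable A : pred V.
Hypotheses (cA : cut T a b A) (Au : A u) (nAv : ~~ A v).

Lemma swap_neq : u != v.
Proof. by apply: contraNneq nAv => <-. Qed.

Lemma swap_new : swap u v.
Proof. by rewrite swapE swap_neq eqxx orbT. Qed.

Lemma swap_cross x y : swap x y -> A x -> ~~ A y -> x = u /\ y = v.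
Proof.
rewrite swapE => /orP[/andP[Txy ne] Ax nAy | /andP[_ /eqP/set2_eq[] [-> ->]]] //.
  by case: cA ne => _ _ /(_ x y Txy Ax nAy)[-> ->]; rewrite eqxx.
by rewrite (negPf nAv).
Qed.

Lemma swap_side (Q : pred V) x p :
  ~~ (Q a && Q b) -> all Q (x :: p) -> path T x p -> path swap x p.
Proof.
move=> nQ; apply: (@sub_in_path _ Q) => c d; rewrite !unfold_in => Qc Qd Tcd.
rewrite swapE Tcd /=; apply/orP; left; apply: contra nQ => /eqP/set2_eq[] [<- <-];
by rewrite Qc Qd.
Qed.

Lemma swap_acyclic : acyclic T -> acyclic swap.
Proof.
move=> acT; apply: cut_acyclic => c d; rewrite swapE => /orP[/andP[Tcd ncd]|].
  have [C cC] := acyclic_cut acT Tcd; have [Cc nCd uC] := cC.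
  have eqA : A c = A d.
    have [_ _ uA] := cA; case: (boolP (A c)) (boolP (A d)) => Ac [] Ad //.
      by have [? ?] := uA c d Tcd Ac Ad; subst; rewrite eqxx in ncd.
    rewrite adj_sym in Tcd; have [? ?] := uA d c Tcd Ad Ac; subst.
    by rewrite setUC eqxx in ncd.
  case: (boolP (C u (+) C v)) => Cuv; last first.
    exists C; split=> // x y; rewrite swapE => /orP[/andP[Txy _]|/andP[_ /eqP/set2_eq]].
      exact: uC.
    by case=> [] [-> ->]; move: Cuv; case: (C u) (C v) => [] [].
  (* Here the new edge crosses [C] as well. Complementing [C] on the side of [A] away from [c] and
     [d] flips exactly one of [u] and [v], hence puts them together; the remaining old edges do not
     cross [A] and are unaffected. *)
  exists (fun x => C x (+) (A x != A c)); split; rewrite ?eqxx ?addbF //.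
    by rewrite -eqA eqxx addbF.
  move=> x y; rewrite swapE => /orP[/andP[Txy ne]|/andP[_ /eqP/set2_eq exy]].
    have -> : A x = A y.
      have [_ _ uA] := cA; case: (boolP (A x)) (boolP (A y)) => Ax [] Ay //.
        by have [? ?] := uA x y Txy Ax Ay; subst; rewrite eqxx in ne.
      rewrite adj_sym in Txy; have [? ?] := uA y x Txy Ay Ax; subst.
      by rewrite setUC eqxx in ne.
    case: (boolP (A y != A c)) => nAyc; last by rewrite !addbF; apply: uC.
    rewrite !addbT negbK => nCx Cy; rewrite adj_sym in Txy.
    by have [yc _] := uC y x Txy Cy nCx; rewrite yc eqxx in nAyc.
  case: exy => [] [-> ->]; rewrite Au (negPf nAv);
    by move: Cuv; case: (C u) (C v) (A c) => [] [] [].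
case/andP=> _ /eqP/set2_eq[] [-> ->].
  by exists A; split=> //; apply: swap_cross.
exists (predC A); split=> [//||x y sxy nAx /negPn Ay]; first by rewrite /= Au.
by rewrite adj_sym in sxy; case: (swap_cross sxy Ay nAx).
Qed.

(* An edge of [G] whose tree path crossed the removed edge is short-cut through
   the new one; the removed edge itself is replaced by the rest of the
   fundamental cycle of the new one. *)
Lemma swap_tree_spanner (R : realFieldType) (t : R) G :
    tree_spanner t G T -> G u v ->
    (forall x y p, G x y -> ~~ T x y -> simple_path T x y p -> A x -> ~~ A y ->
       (u \in x :: p) && (v \in x :: p)) ->
  tree_spanner t G swap.
Proof.
move=> spT Guv viaUV; have [[sTG cT acT] _] := spT.
have /connectedP cT' := cT; have [Aa nAb uA] := cA.
have nA : ~~ (A a && A b) by rewrite Aa.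
have nAC : ~~ (predC A a && predC A b) by rewrite /= Aa.
have cross x y : G x y -> A x -> ~~ A y ->
    exists2 n, walk swap x y n & (n%:R <= t)%R.
  move=> Gxy Ax nAy; case: (boolP (T x y)) => Txy.
    have [-> ->] := uA x y Txy Ax nAy.
    have [p [Tp Up lp] sp] := ex_geodesic (cT' u v).
    have [/allP/(_ _ (mem_last u p))|[p1 [p2 [pE l1 A1 A2]]]] := cut_path cA Tp Up Au.
      by rewrite lp (negPf nAv).
    move: Tp; rewrite pE cat_path => /and3P[Tp1 _ Tp2].
    exists (size p1 + (1 + size p2)); last first.
      apply: le_trans (tree_spanner_adj spT Guv).
      by rewrite -sp pE size_cat add1n.
    apply: (walk_cat (y := u)).
      by apply: walk_sym; exists p1; rewrite ?(swap_side nA).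
    apply: (walk_cat (y := v)); first exact: walk1 swap_new.
    apply: walk_sym; exists p2; first exact: swap_side nAC A2 Tp2.
    by rewrite -lp pE last_cat.
  have [p sp szp] := ex_geodesic (cT' x y); have [Tp Up lp] := sp.
  have := viaUV x y p Gxy Txy sp Ax nAy.
  have [/allP/(_ _ (mem_last x p))|[p1 [p2 [pE l1 A1 A2]]]] := cut_path cA Tp Up Ax.
    by rewrite lp (negPf nAy).
  rewrite pE -cat_cons !mem_cat => /andP[up vp].
  (* As [A u] holds and [A v] fails, [u] comes before the crossing [a b] and [v] after it, so the
     new edge replaces a stretch of length at least one. *)
  have {up} /splitPl up : u \in x :: p1.
    by case/orP: up => // /(allP A2); rewrite /= Au.
  have {vp} /splitPl vp : v \in b :: p2.
    by case/orP: vp => // /(allP A1); rewrite (negPf nAv).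
  case: vp pE A2 => q1 q2 lq1 pE A2; case: up pE l1 A1 => r1 r2 lr1 pE l1 A1.
  move: Tp; rewrite pE !cat_path /= cat_path => /and3P[/andP[Tr1 _] _ /andP[_ Tq2]].
  exists (size r1 + (1 + size q2)); last first.
    apply: le_trans (tree_spanner_adj spT Gxy).
    rewrite ler_nat -szp pE !size_cat /= size_cat -addnA leq_add2l add1n.
    by rewrite (leq_trans _ (leq_addl _ _)) // ltnS leq_addl.
  apply: (walk_cat (y := u)).
    exists r1 => //; apply: swap_side nA _ Tr1.
    by move: A1; rewrite -cat_cons all_cat => /andP[].
  apply: (walk_cat (y := v)); first exact: walk1 swap_new.
  exists q2; last by rewrite -lq1 -lp pE !last_cat /= last_cat.
  rewrite lq1 in Tq2; apply: swap_side nAC _ Tq2.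
  by move: A2; rewrite /= all_cat nAv => /and3P[_ _ ->].
apply: tree_spannerP.
- move=> x y; rewrite swapE => /orP[/andP[/sTG]//|/andP[_ /eqP/set2_eq[] [-> ->]]] //.
  by rewrite adj_sym.
- by apply/connectedP => x y; apply: connect_sub (cT' x y) => c d /sTG/connect1.
- exact: swap_acyclic.
move=> x y Gxy; case: (boolP (A x)) (boolP (A y)) => Ax [] Ay.
- have [p sp szp] := ex_geodesic (cT' x y); have [Tp Up lp] := sp.
  exists (size p); last by rewrite szp (tree_spanner_adj spT).
  exists p => //; apply: swap_side nA _ Tp; apply/allP => z zp.
  by rewrite (cut_path_const cA sp _ zp) ?Ax ?Ay.
- exact: cross.
- have [|n wn le_n] := cross y x _ Ay Ax; first by rewrite adj_sym.
  by exists n => //; apply: walk_sym.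
- have [p sp szp] := ex_geodesic (cT' x y); have [Tp Up lp] := sp.
  exists (size p); last by rewrite szp (tree_spanner_adj spT).
  exists p => //; apply: swap_side nAC _ Tp; apply/allP => z zp /=.
  by rewrite (cut_path_const cA sp _ zp) ?(negPf Ax) ?(negPf Ay).
Qed.

End Swap.

(** * Regions of a plane embedding *)

Section Edges.
Variable V : finType.

Lemma card_le_edges (T : sgraph V) : connected T [set: V] -> #|V| <= #|edges T|.+1.
Proof.
move/connectedP=> cT; rewrite -cardsT.
apply: (card_le_connecting (ends := id)) => [e /mem_edges_set[x [y [-> _]]]|W].
  by rewrite cards2; case: (x != y).
case/set0Pn=> x xW /properP[_ [y _ yW]].
case: (pickP [pred d : V * V | [&& T d.1 d.2, d.1 \in W & d.2 \notin W]]).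
  case=> a b /= /and3P[Tab aW bW]; exists [set a; b]; first by rewrite mem_edges.
  apply/andP; split; apply/set0Pn; first by exists a; rewrite !inE eqxx.
  by exists b; rewrite !inE eqxx orbT bW.
move=> none; suff /closed_connect/(_ _ _ (cT x y)) : closed T W.
  by rewrite xW (negPf yW).
apply: intro_closed => [|a b Tab aW]; first exact: sym_connect_sym (adj_sym T).
by have := none (a, b); rewrite /= Tab aW => /negbFE.
Qed.

Variable G : sgraph V.
Implicit Type d : dart G.

Definition dedge d : {set V} := [set src d; tgt d].

Lemma drevK : involutive (@drev V G).
Proof. by case=> -[x y] Gxy; apply: val_inj. Qed.

Lemma dedge_rev d : dedge (drev d) = dedge d.
Proof. by rewrite /dedge setUC. Qed.

Lemma dedge_eq d d' : dedge d = dedge d' -> d = d' \/ d = drev d'.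
Proof.
case: d d' => [[x y] Gxy] [[x' y'] Gxy'] /set2_eq /= [] [? ?];
  [left | right]; apply: val_inj; rewrite /=; congr (_, _); done.
Qed.

Lemma dedge_edges T d : (dedge d \in edges T) = T (src d) (tgt d).
Proof. exact: mem_edges. Qed.

Lemma mem_edges_dart e : e \in edges G -> exists d, e = dedge d.
Proof.
case/mem_edges_set=> x [y [-> Gxy]].
by exists (exist (fun z : V * V => G z.1 z.2) (x, y) Gxy).
Qed.

End Edges.

Section Regions.
Variables (V : finType) (G : sgraph V) (M : outerplane_embedding G).
Implicit Types (d h k : dart G) (B : {set dart G}) (T : sgraph V) (A : pred V).
Local Notation rot := (rotation M).

Lemma src_rot d : src (rot d) = src d.
Proof. by have := mem_porbit rot 1 d; rewrite expg1 rotationP inE => /eqP. Qed.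

Lemma phi_inj : injective (fun d => rot (drev d)).
Proof. by move=> d d' /perm_inj/(can_inj (@drevK V G)). Qed.

Lemma mem_face_of d d' : (d' \in face_of rot d) = (face_of rot d' == face_of rot d).
Proof.
apply/idP/eqP => [|<-]; last by rewrite inE connect0.
rewrite inE => dd'; apply/setP => k; rewrite !inE.
by rewrite (same_connect (fconnect_sym phi_inj) dd').
Qed.

Lemma mem_face f d : f \in faces M -> (d \in f) = (face_of rot d == f).
Proof. by case/imsetP=> d' _ ->; rewrite mem_face_of. Qed.

Lemma face_of_faces d : face_of rot d \in faces M.
Proof. exact: imset_f. Qed.

(** The dart that follows [drev d] on its face is [rot d]. *)
Lemma face_of_rot d : face_of rot (rot d) = face_of rot (drev d).
Proof. by apply/eqP; rewrite -mem_face_of inE -{2}(drevK d) fconnect1. Qed.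

(* A union of faces, as a set of darts. *)
Definition region B := [forall d, (rot d \in B) == (drev d \in B)].

Lemma regionP B : reflect (forall d, (rot d \in B) = (drev d \in B)) (region B).
Proof. by apply: (iffP forallP) => R d; [apply/eqP | rewrite R]. Qed.

Lemma region_faces (W : {set {set dart G}}) : region [set d | face_of rot d \in W].
Proof. by apply/regionP => d; rewrite !inE face_of_rot. Qed.

Lemma region_face B d d' :
  region B -> face_of rot d = face_of rot d' -> (d \in B) = (d' \in B).
Proof.
move/regionP=> RB /eqP; rewrite -mem_face_of inE => dd'; apply/esym.
apply: (closed_connect _ dd') => x y /eqP <-.
by rewrite RB drevK.
Qed.

Lemma region_tgt B d : region B -> d \in B -> exists2 k, k \in B & src k = tgt d.
Proof.
by move/regionP=> RB dB; exists (rot (drev d)); rewrite ?RB ?drevK ?src_rot.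
Qed.

(* The boundary of a region is an even subgraph, so it meets every edge cut of
   [G] evenly. *)
Lemma region_cut B A : region B ->
  \big[addb/false]_(d | A (src d) && ~~ A (tgt d)) ((d \in B) (+) (drev d \in B))
    = false.
Proof.
move/regionP=> RB.
(* [rot] permutes the darts leaving each vertex, and [rot d] is in [B] exactly when [drev d] is, so
   the two halves of the sum cancel. The darts with both ends in [A] then cancel by reversal. *)
have: \big[addb/false]_(d | A (src d)) ((d \in B) (+) (drev d \in B)) = false.
  rewrite big_split /= (reindex_inj (@perm_inj _ rot)) /=.
  under eq_bigl do rewrite src_rot.
  by under eq_bigr do rewrite RB; rewrite addbb.
rewrite (bigID (fun d => A (tgt d))) /=.
suff -> : \big[addb/false]_(d | A (src d) && A (tgt d))
  ((d \in B) (+) (drev d \in B)) = false by [].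
rewrite big_split /= (reindex_inj (can_inj (@drevK V G))) /=.
by under eq_bigl do rewrite andbC; rewrite addbb.
Qed.

(** Turning around the vertex from [k] to [rot k] is crossing the edge of [k], and no such crossing
    changes membership in [B]. *)
Lemma region_const_at B d d' : region B ->
    (forall k, src k = src d -> (k \in B) = (drev k \in B)) ->
  src d' = src d -> (d' \in B) = (d \in B).
Proof.
move/regionP=> RB noB srcd.
have: d' \in porbit rot d by rewrite rotationP inE srcd.
case/porbitP=> n ->; elim: n => [|n IHn]; first by rewrite expg0 perm1.
have srcn : src ((rot ^+ n)%g d) = src d.
  have : (rot ^+ n)%g d \in porbit rot d by apply: mem_porbit.
  by rewrite rotationP inE => /eqP.
by rewrite expgSr permM RB -noB.
Qed.

(** Among the edges across [A], only [h] can be on the boundary of [B], and [region_cut] forbids a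
    single one. *)
Lemma region_tree_edge B T h A :
    region B -> cut T (src h) (tgt h) A ->
    (forall d, ~~ T (src d) (tgt d) -> A (src d) -> ~~ A (tgt d) ->
       (d \in B) = (drev d \in B)) ->
  (h \in B) = (drev h \in B).
Proof.
move=> RB [Ah nAh uA] noB; have := region_cut A RB.
rewrite (bigD1 h) ?Ah //= big1 ?addbF => [/negbT|d /andP[/andP[Ad nAd] ndh]].
  by rewrite negb_add => /eqP.
case: (boolP (T (src d) (tgt d))) => Td; last by rewrite noB ?addbb.
case/negP: ndh; apply/eqP/val_inj; have [] := uA _ _ Td Ad nAd.
by rewrite /src /tgt; case: (val d) (val h) => [? ?] [? ?] /= -> ->.
Qed.

(** The boundary of [B] is an even subgraph of a tree, hence empty; then [B] contains all darts at a
    vertex or none, and connectedness spreads this to all vertices. *)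
Lemma flood B T : spanning_tree G T -> region B ->
    (forall d, ~~ T (src d) (tgt d) -> (d \in B) = (drev d \in B)) ->
  forall d d', (d \in B) = (d' \in B).
Proof.
move=> [sTG /connectedP cT acT] RB noB.
have allB d : (d \in B) = (drev d \in B).
  case: (boolP (T (src d) (tgt d))) => [Td|]; last exact: noB.
  have [A cA] := acyclic_cut acT Td; apply: region_tree_edge RB cA _ => k nk _ _.
  exact: noB.
pose P := [pred x | [exists d, (src d == x) && (d \in B)]].
have PE d : (src d \in P) = (d \in B).
  apply/existsP/idP => [[k /andP[/eqP kd]]|dB]; last by exists d; rewrite eqxx.
  by rewrite (region_const_at RB (fun k _ => allB k) kd).
have clP : closed T P.
  move=> x y /sTG Gxy; pose d : dart G := exist (fun z : V * V => G z.1 z.2) (x, y) Gxy.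
  by rewrite -[x]/(src d) -[y]/(src (drev d)) !PE.
move=> d d'; rewrite -!PE; exact: closed_connect clP _ _ (cT _ _).
Qed.

(* The faces enclosed by the fundamental cycle of [d0]. *)
Definition fund T d0 B :=
  [&& region B, [disjoint B & fext M], d0 \in B, drev d0 \notin B
    & [forall d, [&& ~~ T (src d) (tgt d), d \in B & drev d \notin B] ==> (d == d0)]].

Lemma fundP T d0 B : reflect
  [/\ region B, (forall d, d \in fext M -> d \notin B), d0 \in B, drev d0 \notin B
    & forall d, ~~ T (src d) (tgt d) -> d \in B -> drev d \notin B -> d = d0]
  (fund T d0 B).
Proof.
apply: (iffP and5P) => [[RB /pred0P dB d0B nd0B /forallP uB]|[RB dB d0B nd0B uB]].
  split=> // d => [df|Td dB' ndB].
    by have := dB d; rewrite /= df andbT => /negbT.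
  by apply/eqP; apply: (implyP (uB d)); rewrite Td dB'.
split=> //; last by apply/forallP => d; apply/implyP => /and3P[*]; apply/eqP/uB.
by apply/pred0P => d /=; apply/negP => /andP[dB' /dB]; rewrite dB'.
Qed.

Lemma fund_cross T d0 B d :
    fund T d0 B -> ~~ T (src d) (tgt d) -> (d \in B) (+) (drev d \in B) ->
  dedge d = dedge d0.
Proof.
case/fundP=> _ _ _ _ uB nTd; case: (boolP (d \in B)) => dB /= ndB.
  by rewrite (uB d).
rewrite -dedge_rev (uB (drev d)) ?drevK //.
by apply: contra nTd; rewrite adj_sym.
Qed.

Lemma fext_dart : exists d, fext M = face_of rot d.
Proof. by have /imsetP[d _ ->] := fext_face M; exists d. Qed.

Lemma mem_fext d : (d \in fext M) = (face_of rot d == fext M).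
Proof. exact: mem_face (fext_face M). Qed.

(* The edges outside a spanning tree are [#|faces M| - 1] in number by Euler's
   formula and connect the faces by [flood], so that none can be spared. *)
Lemma ex_fund T d0 : spanning_tree G T -> ~~ T (src d0) (tgt d0) ->
  exists B, fund T d0 B || fund T (drev d0) B.
Proof.
move=> stT nTd0; apply/existsP/contraT => /existsPn nofund.
have [sTG cT acT] := stT.
pose F := (edges G :\: edges T) :\ dedge d0.
pose ends e := [set face_of rot d | d in [set d | dedge d == e]].
have : #|faces M| <= #|F|.+1.
  apply: (card_le_connecting (ends := ends)) => [e|W W0 Wp].
    rewrite !inE => /and3P[_ _ /mem_edges_dart[d ->]].
    have: ends (dedge d) \subset [set face_of rot d; face_of rot (drev d)].
      apply/subsetP => _ /imsetP[k + ->]; rewrite !inE => /eqP/dedge_eq[] ->.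
        by rewrite eqxx.
      by rewrite eqxx orbT.
    by move/subset_leq_card/leq_trans; apply; rewrite cards2; case: (_ != _).
  pose B := [set d | face_of rot d \in W].
  have RB : region B by apply: region_faces.
  case: (boolP [exists d, [&& ~~ T (src d) (tgt d), dedge d != dedge d0
      & (d \in B) && (drev d \notin B)]]) => [/existsP[d]|/existsPn none].
    case/and3P=> nTd nd0 /andP[]; rewrite !inE => dW ndW.
    exists (dedge d).
      by rewrite !inE nd0 !dedge_edges nTd; apply: (valP d).
    apply/andP; split; apply/set0Pn.
      exists (face_of rot d); rewrite inE dW andbT.
      by apply: imset_f; rewrite inE.
    exists (face_of rot (drev d)); rewrite !inE ndW face_of_faces /= andbT.
    by apply: imset_f; rewrite inE dedge_rev.
  have noB d : ~~ T (src d) (tgt d) -> dedge d != dedge d0 ->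
      (d \in B) = (drev d \in B).
    move=> nTd nd; apply/idP/idP => dB.
      by have := none d; rewrite nTd nd dB negbK.
    have nTd' : ~~ T (src (drev d)) (tgt (drev d)) by rewrite adj_sym.
    by have := none (drev d); rewrite nTd' dedge_rev nd dB drevK negbK.
  have [x fx] := fext_dart.
  (* Such a region without the exterior face would be the one enclosed by the fundamental cycle of
     [d0] or of its reverse, which [nofund] excludes. If [B] contains the exterior face, its
     complement is used. *)
  have key B1 : region B1 -> x \notin B1 -> (d0 \in B1) (+) (drev d0 \in B1) ->
      (forall d, ~~ T (src d) (tgt d) -> dedge d != dedge d0 ->
        (d \in B1) = (drev d \in B1)) -> False.
    move=> RB1 xB1 cross noB1; have := nofund B1; rewrite negb_or.
    have fundk k : k \in B1 -> drev k \notin B1 -> dedge k = dedge d0 -> fund T k B1.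
      move=> kB nkB ek; apply/fundP; split=> // d => [|nTd dB ndB].
        by rewrite mem_fext fx => /eqP/(region_face RB1)->.
      have /dedge_eq[//|dk] : dedge d = dedge k; last by rewrite dk drevK kB in ndB.
      by rewrite ek; apply: contraNeq ndB => /(noB1 d nTd) <-.
    case: (boolP (d0 \in B1)) cross => d0B /= nd0B; first by rewrite fundk.
    by rewrite (fundk (drev d0)) ?drevK ?dedge_rev // andbF.
  have [dB | ndB] := boolP ((d0 \in B) == (drev d0 \in B)).
    have all_eq : forall d d', (d \in B) = (d' \in B).
      apply: (flood stT RB) => d nTd.
      have [/dedge_eq[]->|] := eqVneq (dedge d) (dedge d0).
      - exact/eqP.
      - by rewrite drevK; apply/esym/eqP.
      - exact: noB.
    have /properP[/subsetP sW [_ /imsetP[d' _ ->] nd'W]] := Wp.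
    have /set0Pn[f fW] := W0; have /imsetP[d _ fd] := sW f fW.
    by have := all_eq d d'; rewrite !inE -fd fW (negPf nd'W).
  have crossB : (d0 \in B) (+) (drev d0 \in B) by rewrite -negb_eqb.
  exfalso; case: (boolP (x \in B)) => xB; last exact: key RB xB crossB noB.
  apply: (key (~: B)).
  - by apply/regionP => d; rewrite !in_setC; have /regionP-> := RB.
  - by rewrite in_setC xB.
  - by rewrite !in_setC addNb addbN negbK.
  - by move=> d nTd nd; rewrite !in_setC noB.
(* With [dedge d0] spared, the bounds on vertices and faces add up to at most [#|edges G| + 1], one
   less than Euler's formula requires. *)
have := card_le_edges cT; have := Euler M; rewrite -/(faces M).
have : dedge d0 \in edges G :\: edges T.
  by rewrite inE !dedge_edges nTd0; apply: (valP d0).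
rewrite /F => e0; have := cardsD1 (dedge d0) (edges G :\: edges T); rewrite e0 => cF.
have sE : edges T \subset edges G.
  by apply/subsetP => e /mem_edges_set[x [y [-> /sTG]]]; rewrite mem_edges.
have := cardsID (edges T) (edges G); rewrite (setIidPr sE) cF.
set nF := #|_ :\ _|; set nT := #|edges T|; set nG := #|edges G|.
set nV := #|V|; set nM := #|faces M|; clearbody nF nT nG nV nM.
clear; lia.
Qed.

End Regions.

(** * Fundamental cycles and the regions that they bound *)

Section Fundamental.
Variables (V : finType) (G : sgraph V) (M : outerplane_embedding G).
Implicit Types (d h k : dart G) (B : {set dart G}) (T : sgraph V) (A : pred V).
Local Notation rot := (rotation M).

(* The fundamental cycle of [d0] is the boundary of its region. *)
Lemma fund_tree_edge T d0 B h A :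
    fund M T d0 B -> ~~ T (src d0) (tgt d0) -> T (src h) (tgt h) ->
    cut T (src h) (tgt h) A ->
  (h \in B) (+) (drev h \in B) = A (src d0) (+) A (tgt d0).
Proof.
move=> fB nTd0 Th cA; have [RB _ d0B nd0B _] := fundP _ _ _ _ fB.
have only d : ~~ T (src d) (tgt d) -> (d \in B) (+) (drev d \in B) ->
    d = d0 \/ d = drev d0.
  by move=> nTd /(fund_cross fB nTd)/dedge_eq.
have [A0|] := boolP (A (src d0) (+) A (tgt d0)); last first.
  rewrite negb_add => /eqP A0; apply/negbTE; rewrite negb_add; apply/eqP.
  apply: region_tree_edge RB cA _ => d nTd Ad nAd; apply/eqP.
  rewrite -[_ == _]negbK negb_eqb; apply/negP => /only - /(_ nTd) [] dE; subst d.
    by rewrite A0 (negPf nAd) in Ad.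
  by move: nAd; rewrite -[tgt (drev d0)]/(src d0) A0 -[tgt d0]/(src (drev d0)) Ad.
(* [k] is the orientation of [d0] that leaves [A]. Only [h] and [k] can contribute to the even sum
   over the cut, so [h] contributes because [k] does. *)
have [k [Ak nAk kB nTk kE]] : exists k, [/\ A (src k), ~~ A (tgt k),
    (k \in B) (+) (drev k \in B), ~~ T (src k) (tgt k) & k = d0 \/ k = drev d0].
  case: (boolP (A (src d0))) A0 => Ad0 /= nAd0.
    by exists d0; split=> //; [rewrite d0B | left].
  exists (drev d0); split=> [//|//|||]; last by right.
    by rewrite drevK d0B (negPf nd0B).
  by rewrite -[src (drev d0)]/(tgt d0) adj_sym.
have [Ah nAh uA] := cA; have := region_cut A RB.
have nkh : k != h by apply: contraNneq nTk => ->.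
rewrite (bigD1 h) ?Ah //= (bigD1 k) ?Ak ?nAk //= kB big1 => [|d].
  by rewrite addbF addbT => /negbFE.
case/andP=> /andP[/andP[Ad nAd] ndh] ndk.
have nTd : ~~ T (src d) (tgt d).
  apply: contra ndh => Td; apply/eqP/val_inj; have [] := uA _ _ Td Ad nAd.
  by rewrite /src /tgt; case: (val d) (val h) => [? ?] [? ?] /= -> ->.
apply/negbTE/negP => /(only _ nTd) dE.
have dk : d = drev k.
  by case: dE kE ndk => -> [] ->; rewrite ?eqxx ?drevK.
by move: Ad; rewrite dk -[src (drev k)]/(tgt k) (negPf nAk).
Qed.

(** Some dart of the exterior face also leaves [src d], and it is not in [B]; so membership in [B]
    changes somewhere around this vertex. *)
Lemma region_touch B d : region M B -> (forall k, k \in fext M -> k \notin B) ->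
  d \in B -> exists2 k, src k = src d & (k \in B) (+) (drev k \in B).
Proof.
move=> RB extB dB; have [e ef es] := fextP M (src d).
case: (pickP [pred k | (src k == src d) && ((k \in B) (+) (drev k \in B))]).
  by move=> k /andP[/eqP ks kB]; exists k.
move=> none; have := extB e ef; rewrite (region_const_at RB _ es) ?dB // => k ks.
by apply/eqP; have := none k; rewrite /= ks eqxx -negb_eqb => /negbFE.
Qed.

Lemma set2_addb x y d A : [set x; y] = dedge d -> A x (+) A y = A (src d) (+) A (tgt d).
Proof. by case/set2_eq=> [] [-> ->] //; rewrite addbC. Qed.

(** The boundary edge given by [region_touch] is either a tree edge separating [x] from [y], hence
    on the path, or the edge of [d0]. *)
Lemma fund_touch T d0 B d x y p :
    spanning_tree G T -> fund M T d0 B -> ~~ T (src d0) (tgt d0) ->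
    simple_path T x y p -> [set x; y] = dedge d0 ->
  d \in B -> src d \in x :: p.
Proof.
move=> [_ _ acT] fB nTd0 sp xyE dB; have [RB extB _ _ _] := fundP _ _ _ _ fB.
have [k <- kB] := region_touch RB extB dB.
case: (boolP (T (src k) (tgt k))) => Tk.
  have [A cA] := acyclic_cut acT Tk.
  have := kB; rewrite (fund_tree_edge fB nTd0 Tk cA) -(set2_addb A xyE).
  by case/(cut_mem_path cA sp)/andP.
have : src k \in [set x; y] by rewrite xyE -(fund_cross fB Tk kB) set21.
have [_ _ <-] := sp; rewrite in_set2 => /orP[] /eqP ->; first exact: mem_head.
exact: mem_last.
Qed.

(* The first edge on the way from a face to the exterior face, in the tree dual
   to the complement of [T]. *)
Lemma ex_fund_inward T d : spanning_tree G T -> d \notin fext M ->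
  exists d1 B, [/\ d1 \in face_of rot d, ~~ T (src d1) (tgt d1) & fund M T d1 B].
Proof.
move=> stT dext; set f := face_of rot d.
case: (boolP [exists d1, [exists B, [&& d1 \in f, ~~ T (src d1) (tgt d1)
    & fund M T d1 B]]]) => [/existsP[d1 /existsP[B /and3P[? ? ?]]]|nof].
  by exists d1, B.
have nofund d1 B : d1 \in f -> ~~ T (src d1) (tgt d1) -> ~~ fund M T d1 B.
  move=> d1f nTd1; apply: contra nof => fB; apply/existsP; exists d1.
  by apply/existsP; exists B; rewrite d1f nTd1.
(* If no edge of [f] leads towards the exterior face, each edge of [f] off [T] cuts off a region on
   its other side. The union of [f] and these regions has no boundary edge off [T], so by [flood] it
   contains the exterior face, though none of its parts does. *)
pose U := [set k | (k \in f) || [exists d1, [exists B,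
   [&& d1 \in f, ~~ T (src d1) (tgt d1), fund M T (drev d1) B & k \in B]]]].
have UP k : reflect (k \in f \/ exists d1 B, [/\ d1 \in f, ~~ T (src d1) (tgt d1),
    fund M T (drev d1) B & k \in B]) (k \in U).
  rewrite [k \in U]in_set; apply: (iffP orP) => [] [kf|]; first by left.
  - by case/existsP=> d1 /existsP[B /and4P[]]; right; exists d1, B.
  - by left.
  case=> d1 [B [d1f nTd1 fB kB]]; right; apply/existsP; exists d1.
  by apply/existsP; exists B; rewrite d1f nTd1 fB.
have rot_f k : (rot k \in f) = (drev k \in f) by rewrite !mem_face_of face_of_rot.
have RU : region M U.
  apply/regionP => k; apply/UP/UP; rewrite rot_f => -[kf|]; try by left.
    case=> d1 [B [d1f nTd1 fB kB]]; right; exists d1, B; split=> //.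
    by have [RB _ _ _ _] := fundP _ _ _ _ fB; rewrite -(regionP _ _ RB).
  case=> d1 [B [d1f nTd1 fB kB]]; right; exists d1, B; split=> //.
  by have [RB _ _ _ _] := fundP _ _ _ _ fB; rewrite (regionP _ _ RB).
have noU k : ~~ T (src k) (tgt k) -> k \in U -> drev k \in U.
  move=> nTk /UP[kf|[d1 [B [d1f nTd1 fB kB]]]]; apply/UP.
    have [B] := ex_fund M stT nTk; rewrite (negPf (nofund k B kf nTk)) /= => fB.
    by right; exists k, B; split=> //; have [] := fundP _ _ _ _ fB.
  have [_ _ _ _ uB] := fundP _ _ _ _ fB.
  case: (boolP (drev k \in B)) => kB'; first by right; exists d1, B.
  by left; rewrite (uB k nTk kB kB') drevK.
have Uf : d \in U by apply/UP; left; rewrite inE connect0.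
have [x fx] := fext_dart M.
have : x \in U.
  rewrite -(flood stT RU _ d x) // => k nTk; apply/idP/idP; first exact: noU.
  by move=> kU; rewrite -(drevK k); apply: noU => //; rewrite adj_sym.
have xext : x \in fext M by rewrite mem_fext fx.
case/UP=> [|[d1 [B [_ _ /fundP[_ extB _ _ _]]]]]; last by rewrite (negPf (extB x xext)).
by rewrite mem_face_of -fx => /eqP xd; rewrite mem_fext xd eqxx in dext.
Qed.

End Fundamental.

(** * External edges *)

Section External.
Variables (V : finType) (G : sgraph V) (M : outerplane_embedding G).
Implicit Types (d h k : dart G) (B : {set dart G}) (T : sgraph V) (A : pred V).
Local Notation rot := (rotation M).

Lemma dedge_external d :
  (dedge d \in external_edges M) = (d \in fext M) || (drev d \in fext M).
Proof.
apply/imsetP/orP => [[k kf /dedge_eq[]->]|[] df]; rewrite ?drevK; try by auto.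
  by exists d.
by exists (drev d) => //; rewrite -[RHS]/(dedge (drev d)) dedge_rev.
Qed.

Lemma face_external_edge f e :
    f \in interior_faces M -> e \in face_edges f :&: external_edges M ->
  exists d, [/\ e = dedge d, face_of rot d = f, d \notin fext M & drev d \in fext M].
Proof.
rewrite !inE => /andP[nf fM] /andP[/imsetP[d df ->]].
rewrite -/(dedge d) dedge_external; have dfE := df; rewrite (mem_face _ fM) in dfE.
have ndf : d \notin fext M by rewrite mem_fext (eqP dfE).
by rewrite (negPf ndf) /= => rdf; exists d; split=> //; apply/eqP.
Qed.

Lemma fund_external T d : spanning_tree G T -> ~~ T (src d) (tgt d) ->
  drev d \in fext M -> exists B, fund M T d B.
Proof.
move=> stT nTd df; have [B /orP[|/fundP[_ /(_ _ df)]]] := ex_fund M stT nTd.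
  by exists B.
by move=> /negPf->.
Qed.

(** The region of [d] contains the common face and not the exterior one, so [d'] also crosses its
    boundary off [T], where [d] is the only such dart. *)
Lemma external_nontree_inj T d d' : spanning_tree G T ->
    face_of rot d = face_of rot d' -> drev d \in fext M -> drev d' \in fext M ->
  ~~ T (src d) (tgt d) -> ~~ T (src d') (tgt d') -> d = d'.
Proof.
move=> stT dd' df d'f nTd nTd'; have [B fB] := fund_external stT nTd df.
have [RB extB dB _ uB] := fundP _ _ _ _ fB.
by apply/esym/uB; rewrite ?(extB _ d'f) // (region_face RB (esym dd')).
Qed.

Lemma P1_of_ex T : spanning_tree G T ->
    (forall f, f \in E_faces M ->
       exists2 e, e \in face_edges f :&: external_edges M & e \notin edges T) ->
  P1 M T.
Proof.
move=> stT exT f fE; have [e ef neT] := exT f fE.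
have fI : f \in interior_faces M by move: fE; rewrite inE => /andP[].
apply/eqP/cards1P; exists e; apply/setP => e'; rewrite in_set1 inE.
apply/andP/eqP => [[e'f ne'T]|-> //].
have [d [eE dface _ dext]] := face_external_edge fI ef.
have [d' [e'E d'face _ d'ext]] := face_external_edge fI e'f.
rewrite eE e'E !dedge_edges in neT ne'T *.
by congr dedge; apply: external_nontree_inj stT _ _ _ _ _; rewrite ?dface.
Qed.

Lemma external_descent (R : realFieldType) (t : R) T f :
    tree_spanner t G T -> f \in E_faces M ->
    face_edges f :&: external_edges M \subset edges T ->
  exists2 T' : sgraph V, tree_spanner t G T' &
    #|external_edges M :&: edges T'| < #|external_edges M :&: edges T|.
Proof.
move=> spT fE /subsetP allT; have [stT _] := spT; have [sTG _ acT] := stT.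
have /andP[fI /set0Pn[e ef]] : (f \in interior_faces M) &&
  (face_edges f :&: external_edges M != set0) by move: fE; rewrite inE.
have [d2 [eE d2f nd2 rd2]] := face_external_edge fI ef.
have Td2 : T (src d2) (tgt d2) by rewrite -dedge_edges -eE allT.
have [d1 [B [d1f nTd1 fB]]] := ex_fund_inward stT nd2.
have {d1f} d12 : face_of rot d1 = face_of rot d2 by apply/eqP; rewrite -mem_face_of.
have [A cA] := acyclic_cut acT Td2.
(* The other side of [d2] is exterior, so [d2] is on a fundamental cycle exactly when that cycle
   encloses [f], the face of [d1]. *)
have crossd2 k Z : fund M T k Z -> ~~ T (src k) (tgt k) ->
    A (src k) (+) A (tgt k) = (d1 \in Z).
  move=> fZ nTk; have [RZ extZ _ _ _] := fundP _ _ _ _ fZ.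
  rewrite -(fund_tree_edge fZ nTk Td2 cA) (negPf (extZ _ rd2)) addbF.
  exact: region_face RZ (esym d12).
have [u [v [uvE Au nAv]]] : exists u v, [/\ [set u; v] = dedge d1, A u & ~~ A v].
  have := crossd2 _ _ fB nTd1; have [_ _ -> _ _] := fundP _ _ _ _ fB.
  case: (boolP (A (src d1))) => Ad1 /= nAd1.
    by exists (src d1), (tgt d1); split=> //; rewrite nAd1.
  by exists (tgt d1), (src d1); split=> //; rewrite setUC.
have spT' : tree_spanner t G (swap T (src d2) (tgt d2) u v).
  apply: (swap_tree_spanner cA Au nAv spT).
    by rewrite -mem_edges uvE dedge_edges; apply: (valP d1).
  move=> x y p Gxy nTxy sp Ax nAy.
  pose g : dart G := exist (fun z : V * V => G z.1 z.2) (x, y) Gxy.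
  have [Z fZ] := ex_fund M stT (nTxy : ~~ T (src g) (tgt g)).
  have [k [fk nTk xyE]] : exists k, [/\ fund M T k Z, ~~ T (src k) (tgt k)
      & [set x; y] = dedge k].
    case/orP: fZ => fZ; first by exists g.
    by exists (drev g); split=> //; [rewrite adj_sym | rewrite dedge_rev].
  have d1Z : d1 \in Z.
    by rewrite -(crossd2 _ _ fk nTk) -(set2_addb A xyE) Ax.
  have [RZ _ _ _ _] := fundP _ _ _ _ fk.
  have [k' k'Z k'E] := region_tgt RZ d1Z.
  have srcp := fund_touch stT fk nTk sp xyE d1Z.
  have tgtp := fund_touch stT fk nTk sp xyE k'Z; rewrite k'E in tgtp.
  by case/set2_eq: uvE => [] [-> ->]; rewrite srcp tgtp.
exists (swap T (src d2) (tgt d2) u v) => //.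
(* The external edge [e] leaves the tree. The new edge is not external: it is an edge of [f] outside
   [T], and all external edges of [f] are in [T]. *)
rewrite [ltnRHS](cardsD1 e) inE (allT e ef) andbT.
have -> : e \in external_edges M by move: ef; rewrite inE => /andP[].
rewrite add1n ltnS; apply: subset_leq_card; apply/subsetP => e'.
rewrite !inE swap_mem_edges => /andP[e'ext /orP[/andP[e'T ne']|/andP[_ /eqP e'E]]].
  by rewrite eE ne' e'ext.
case/negP: nTd1; rewrite -dedge_edges; apply: allT.
rewrite inE -uvE -e'E e'ext andbT e'E uvE.
have /setD1P[_ fM] := fI.
by apply: imset_f; rewrite (mem_face _ fM) d12 d2f.
Qed.

Lemma ex_P1_spanner (R : realFieldType) (t : R) T :
  tree_spanner t G T -> exists2 T' : sgraph V, tree_spanner t G T' & P1 M T'.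
Proof.
have [n] := ubnP #|external_edges M :&: edges T|; elim: n T => // n IHn T le_n spT.
case: (boolP [exists f in E_faces M,
                face_edges f :&: external_edges M \subset edges T]).
  case/exists_inP=> f fE allT; have [T' spT' lt] := external_descent spT fE allT.
  by apply: IHn spT'; apply: leq_trans lt _.
move/exists_inPn=> none; exists T => //.
apply: P1_of_ex => [|f /none]; first by case: spT.
by case/subsetPn=> e; exists e.
Qed.

(* The chord [d] and the path between its ends would enclose a region disjoint
   from [B], which cuts the inner vertices of that path off the exterior face. *)
Lemma no_outer_chord T d0 B d u v p :
    spanning_tree G T -> fund M T d0 B ->
    ~~ T (src d0) (tgt d0) -> ~~ T (src d) (tgt d) ->
    drev d0 \in fext M -> drev d \in fext M -> d \notin B ->
    simple_path T u v p -> [set u; v] = dedge d0 ->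
  src d \in u :: p -> tgt d \in u :: p -> False.
Proof.
move=> stT fB nTd0 nTd d0ext dext ndB sp uvE srcp tgtp.
have [sTG _ acT] := stT; have [C fC] := fund_external stT nTd dext.
have [RB extB d0B _ uB] := fundP _ _ _ _ fB.
have [RC extC dC _ uC] := fundP _ _ _ _ fC.
(* Off [T], only the edges of [d0] and [d] could bound [B :&: C], and neither does because [d] is
   outside [B]. By [flood] the intersection is empty. *)
have disj k : (k \in B) && (k \in C) = false.
  have RI : region M (B :&: C).
    by apply/regionP => k'; rewrite !inE (regionP _ _ RB) (regionP _ _ RC).
  have noI k' : ~~ T (src k') (tgt k') -> k' \in B :&: C -> drev k' \in B :&: C.
    move=> nTk; rewrite !inE => /andP[kB kC]; apply/contraT; rewrite negb_and.
    case/orP=> nk; last by rewrite (uC _ nTk kC nk) (negPf ndB) in kB.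
    have E := uB _ nTk kB nk; rewrite E in kC.
    by rewrite -(uC _ nTd0 kC (extC _ d0ext)) d0B in ndB.
  rewrite -in_setI (flood stT RI _ k (drev d)).
    by rewrite inE (negPf (extB _ dext)).
  move=> k' nTk; apply/idP/idP; first exact: noI.
  by move=> kI; rewrite -(drevK k'); apply: noI => //; rewrite adj_sym.
have RD : region M (B :|: C).
  by apply/regionP => k'; rewrite !inE (regionP _ _ RB) (regionP _ _ RC).
have inD k : (k \in B :|: C) = (k \in B) (+) (k \in C).
  by rewrite inE; move: (disj k); case: (k \in B) (k \in C) => [] [].
have nd : src d != tgt d.
  apply: contraTneq (valP d) => E.
  by rewrite -[X in G X _]/(src d) -[X in G _ X]/(tgt d) E adj_irr.
have [a [b [s1 [s2 [s3 [pE abE]]]]]] : exists a b s1 s2 s3,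
    u :: p = s1 ++ a :: s2 ++ b :: s3 /\ [set a; b] = dedge d.
  have [s1 [s2 [s3 [E|E]]]] := split_two srcp tgtp nd.
    by exists (src d), (tgt d), s1, s2, s3.
  by exists (tgt d), (src d), s1, s2, s3; rewrite setUC.
have [Tp Up lp] := sp.
have Tas : path T a (s2 ++ b :: s3).
  by move: (Tp : sorted T (u :: p)); rewrite pE => /cat_sorted2[].
case: s2 pE Tas => [|w s2] pE /= /andP[Tab _].
  by case/negP: nTd; rewrite -dedge_edges -abE mem_edges.
have wp : w \in u :: p by rewrite pE !mem_cat !inE eqxx /= !orbT.
have ap : a \in u :: p by rewrite pE mem_cat mem_head orbT.
have bp : b \in u :: p by rewrite pE mem_cat !inE mem_cat mem_head !orbT.
have pE' : u :: p = (s1 ++ [:: a]) ++ w :: (s2 ++ b :: s3) by rewrite pE -catA.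
have /andP[nw1 nw2] : (w \notin s1 ++ [:: a]) && (w \notin s2 ++ b :: s3).
  by move: Up; rewrite pE' cat_uniq /= negb_or => /and4P[_ /andP[-> _] ->].
have wNends : w \notin [set u; v].
  rewrite in_set2 negb_or; apply/andP; split.
    apply: contraNneq nw1 => ->.
    by case: s1 pE {pE'} => [|? ?] [-> _]; rewrite mem_head.
  apply: contraNneq nw2 => ->.
  rewrite -lp -[last u p]/(last u (u :: p)) pE' last_cat /=.
  by rewrite last_cat last_cons mem_cat mem_last orbT.
have wNab : w \notin [set a; b].
  rewrite in_set2 negb_or; apply/andP; split.
    by apply: contraNneq nw1 => ->; rewrite mem_cat mem_head orbT.
  by apply: contraNneq nw2 => ->; rewrite mem_cat mem_head orbT.
have Twa : T w a by rewrite adj_sym.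
pose h : dart G := exist (fun z : V * V => G z.1 z.2) (w, a) (sTG _ _ Twa).
have [k0 k0B k0w] : exists2 k, k \in B & src k = w.
  have [A cA] := acyclic_cut acT Twa.
  have : (h \in B) (+) (drev h \in B).
    rewrite (fund_tree_edge fB nTd0 (Twa : T (src h) (tgt h)) cA) -(set2_addb A uvE).
    exact: cut_path_sep cA sp wp ap.
  case: (boolP (h \in B)) => [hB _|_ /= rhB]; first by exists h.
  by exists (rot h); rewrite ?(regionP _ _ RB) ?src_rot.
have extD k : k \in fext M -> k \notin B :|: C.
  by move=> kf; rewrite inE negb_or extB ?extC.
(* By disjointness, the boundary of the union is the symmetric difference of the two boundaries. At
   [w], strictly between [a] and [b], a tree edge is on both fundamental cycles or on neither, and
   the edges of [d0] and [d] do not end there. *)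
have [|k ks] := region_touch RD extD (d := k0); first by rewrite inE k0B.
rewrite !inD addbACA k0w in ks *.
case: (boolP (T (src k) (tgt k))) => Tk; last first.
  case: (boolP ((k \in B) (+) (drev k \in B))) => [kB _|_ /= kC].
    by case/negP: wNends; rewrite uvE -(fund_cross fB Tk kB) -ks set21.
  by case/negP: wNab; rewrite abE -(fund_cross fC Tk kC) -ks set21.
have [A cA] := acyclic_cut acT Tk.
rewrite (fund_tree_edge fB nTd0 Tk cA) (fund_tree_edge fC nTd Tk cA).
rewrite -(set2_addb A uvE) -(set2_addb A abE); rewrite ks in cA.
case: (boolP (A u (+) A v)) => Auv.
  by rewrite (cut_path_segment cA sp pE (mem_head _ _) Auv).
move: Auv; rewrite negb_add => /eqP Auv.
by rewrite (cut_path_const cA sp Auv ap) (cut_path_const cA sp Auv bp) addbb.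
Qed.

Lemma P2_of_P1 T : spanning_tree G T -> P1 M T -> P2 M T.
Proof.
move=> stT P1T u v p /imsetP[x xext uvE] uvT sp.
pose d0 := drev x; have {}uvE : [set u; v] = dedge d0 by rewrite dedge_rev.
have d0ext : drev d0 \in fext M by rewrite drevK.
have nTd0 : ~~ T (src d0) (tgt d0) by rewrite -dedge_edges -uvE.
have [B fB] := fund_external stT nTd0 d0ext.
have [RB extB d0B _ uB] := fundP _ _ _ _ fB.
set S := [set z in u :: p]; pose f0 := face_of rot d0.
(* The faces inside [B] keep all their edges in [G[S]], so [f0] merges with no other face. *)
have BS d : d \in B -> induced G S (src d) (tgt d).
  move=> dB; have [k kB kE] := region_tgt RB dB.
  rewrite /induced /= !in_set (valP d) andbT -kE.
  by rewrite !(fund_touch stT fB nTd0 sp uvE).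
have only_f0 f : connect (merged M S) f0 f -> f = f0.
  case/connectP=> [[|g q] //= /andP[/existsP[d /and3P[/negP nind /eqP df _]]]].
  by case: nind; apply: BS; rewrite (region_face RB df).
have d0next : d0 \notin fext M by apply: contraL d0B; apply: extB.
have f0E : f0 \in E_faces M.
  rewrite !inE face_of_faces -mem_fext d0next /=; apply/set0Pn; exists (dedge d0).
  by rewrite inE dedge_external d0ext orbT andbT imset_f // mem_face_of.
apply/eqP/cards1P; exists [set f0]; apply/setP => K; rewrite in_set1.
apply/idP/eqP => [|->].
  rewrite !inE -andbA => /and3P[/imsetP[k kM KE] extK /exists_inP[f fE /eqP Kf]].
  have kf : k = f by apply/eqP; rewrite -in_set1 -Kf KE inE kM connect0.
  rewrite {}kf {k} in kM KE; suff <- : f = f0 by [].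
  (* Take the external edge of [f] off [T]. If it is not in [G[S]], then [f] merges with the
     exterior face; if its dart is in [B], it is [d0]; otherwise it is a chord excluded by
     [no_outer_chord]. *)
  have /eqP/cards1P[e /setP/(_ e)] := P1T f fE.
  rewrite in_set1 eqxx inE => /andP[ef neT].
  have fI : f \in interior_faces M by move: fE; rewrite inE => /andP[].
  have [d [eE df ndext dext]] := face_external_edge fI ef.
  have nTd : ~~ T (src d) (tgt d) by rewrite -dedge_edges -eE.
  have [/and3P[srcS tgtS _]|nind] := boolP (induced G S (src d) (tgt d)); last first.
    case/negP: extK; rewrite KE inE (fext_face M : fext M \in faces M) connect1 //=.
    by apply/existsP; exists d; rewrite nind df eqxx -mem_fext.
  have [dB|ndB] := boolP (d \in B).
    by rewrite -df (uB d nTd dB (extB _ dext)).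
  rewrite !in_set in srcS tgtS.
  by case: (no_outer_chord stT fB nTd0 nTd d0ext dext ndB sp uvE).
rewrite !inE -andbA; apply/and3P; split.
- apply/imsetP; exists f0; first exact: face_of_faces.
  apply/setP => f; rewrite !inE; apply/eqP/andP => [->|[_ /only_f0 //]].
  by rewrite face_of_faces connect0.
- by rewrite eq_sym -mem_fext.
by apply/exists_inP; exists f0.
Qed.

End External.

Theorem theorem2 (V : finType) (G : sgraph V) (M : outerplane_embedding G)
    (R : realFieldType) (t : R) :
  biconnected G ->
  (exists T : sgraph V, tree_spanner t G T) ->
  exists T : sgraph V, [/\ tree_spanner t G T, P1 M T & P2 M T].
Proof.
move=> _ [T0 /(ex_P1_spanner M)[T spT P1T]]; exists T; split=> //.
by apply: P2_of_P1 P1T; case: spT.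
Qed.
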